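(* Let $\mathbf{k}$ be a field and let $(X,r)$ be a left nondegenerate idempotent solution of the Yang-Baxter equation, with $|X|=n\ge 2$, whose Yang-Baxter algebra $\mathcal{A}=\mathcal{A}(\mathbf{k},X,r)$ is PBW with a set of PBW-generators $X=\{x_1,\dots,x_n\}$. (1) There are inequalities $$n\le\dim\mathcal{A}_2\le\binom n2+1.$$ Equivalently, the reduced Gröbner basis for $\mathcal{A}$ consists of $N$ linearly independent quadratic binomials, where $$\binom{n+1}{2}-1\le N=|\mathbf{W}|\le n(n-1).$$ (2) The lower bound $n\le\dim\mathcal{A}_2$ is exact (i.e. it is attained by some such solution of order $n$). Moreover, if $\dim\mathcal{A}_2=n$, then $\dim\mathcal{A}_d=n$ for all $d\ge1$.
   Context: For a map $r:X\times X\to X\times X$ write $r(x,y)=({}^xy,x^y)$. $(X,r)$ is left nondegenerate if $y\mapsto{}^xy$ is a bijection of $X$ for each $x\in X$; idempotent if $r^2=r$; a solution of the Yang-Baxter equation if $r^{12}r^{23}r^{12}=r^{23}r^{12}r^{23}$ on $X^3$, with $r^{12}=r\times\mathrm{id}$, $r^{23}=\mathrm{id}\times r$. The Yang-Baxter algebra is $\mathcal{A}(\mathbf{k},X,r)=\mathbf{k}\langle X\rangle/I$, where $I$ is the two-sided ideal generated by all $xy-y'x'$ with $r(x,y)=(y',x')$, $x,y\in X$; it is graded by word length, $\mathcal{A}=\bigoplus_{d\ge0}\mathcal{A}_d$. It is PBW with PBW-generators $x_1,\dots,x_n$ (in this order) if $I$ has a Gröbner basis of homogeneous quadratic polynomials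 with respect to the degree-lexicographic order on words with $x_1<\dots<x_n$. $\mathbf{W}$ denotes the set of leading monomials of the reduced Gröbner basis of $I$. *)

(* Defs.v *)
From HB Require Import structures.
From mathcomp Require Import all_boot all_order all_algebra.
From mathcomp Require Import finmap monalg.
From mathcomp Require Import mathcomp_extra boolp classical_sets functions.
From mathcomp Require Import cardinality.

Set Implicit Arguments.
Unset Strict Implicit.
Unset Printing Implicit Defensive.

Import Order.TTheory GRing.Theory.

Local Open Scope classical_set_scope.
Local Open Scope quotient_scope.
Local Open Scope ring_scope.

Section Dimension.
Context {k : fieldType} {V : lmodType k}.

Definition lin_indep (m : nat) (b : 'I_m -> V) : Prop :=
  forall c : 'I_m -> k, \sum_(i < m) c i *: b i = 0 -> forall i, c i = 0.

(* The subspace S has dimension m. This is a relation rather than a function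
   because V may be infinite-dimensional. *)
Definition has_dim (S : set V) (m : nat) : Prop :=
  exists b : 'I_m -> V,
    [/\ forall i, S (b i), lin_indep b &
        forall v, S v -> exists c : 'I_m -> k, v = \sum_(i < m) c i *: b i].

End Dimension.

Section Ideals.
Context {R : nzRingType}.

Definition two_sided_ideal (I : set R) : Prop :=
  [/\ I 0, forall f g, I f -> I g -> I (f + g) &
      forall a f b, I f -> I (a * f * b)].

Definition gen_ideal (S : set R) : set R := smallest two_sided_ideal S.

Lemma gen_ideal_ideal (S : set R) : two_sided_ideal (gen_ideal S).
Proof.
split=> [|f g If Ig|a f b If] J HJ; have [[J0 JD JM] _] := HJ => //.
- by apply: JD; [apply: If | apply: Ig].
- by apply: JM; apply: If.
Qed.

Definition gen_idealb (S : set R) : {pred R} := fun f => `[< gen_ideal S f >].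

Lemma gen_idealbP (S : set R) f : reflect (gen_ideal S f) (f \in gen_idealb S).
Proof. exact: asboolP. Qed.

Lemma gen_idealb_zmod (S : set R) : zmod_closed (gen_idealb S).
Proof.
have [I0 ID IM] := gen_ideal_ideal S.
split=> [|f g /gen_idealbP If /gen_idealbP Ig]; apply/gen_idealbP => //.
apply: ID => //; rewrite -mulN1r -[_ * g]mulr1; exact: IM.
Qed.

HB.instance Definition _ (S : set R) :=
  GRing.isZmodClosed.Build R (gen_idealb S) (gen_idealb_zmod S).

End Ideals.

Notation freealg k X := {malg k[{fmonom X}]}.

Lemma malg_scalerAr (K : monomType) (R : comNzRingType) (c : R)
    (f g : {malg R[K]}) :
  c *: (f * g) = f * (c *: g).
Proof.
apply/malgP => w; rewrite mcoeffZ mcoeffMl.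
rewrite (@mcoeffMlw _ _ (msupp f) (msupp g) f (c *: g) w
  (fsubset_refl _) (msuppZ_le c g)).
rewrite mulr_sumr; apply: eq_bigr => u _.
rewrite mulr_sumr; apply: eq_bigr => v _.
by rewrite mcoeffZ mulrnAr mulrCA.
Qed.

Section YangBaxterAlgebra.
Context {X : choiceType} (k : fieldType) (r : X * X -> X * X).

Definition fgen (x : X) : freealg k X := << fmu x >>.

Definition yb_relations : set (freealg k X) :=
  [set f | exists x y : X,
     f = fgen x * fgen y - fgen (r (x, y)).1 * fgen (r (x, y)).2].

Definition yb_ideal : set (freealg k X) := gen_ideal yb_relations.

Local Notation S := (gen_idealb yb_relations).

Definition yb_algebra : Type := Quotient.quot S.
Local Notation A := yb_algebra.

HB.instance Definition _ := GRing.Zmodule.copy A (Quotient.quot S).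
HB.instance Definition _ := EqQuotient.copy A (Quotient.quot S).

Lemma yb_eqP (f g : freealg k X) :
  (\pi_A f = \pi_A g) <-> yb_ideal (f - g).
Proof.
split=> [/eqP|fg].
  by rewrite -[_ == _](Quotient.idealrBE S) => /gen_idealbP.
apply/eqP; rewrite -[_ == _](Quotient.idealrBE S).
exact/gen_idealbP.
Qed.

Lemma yb_piD : {morph \pi_A : f g / f + g}.
Proof. exact: (@Quotient.pi_add _ S). Qed.

Lemma yb_pi0 : \pi_A 0 = 0.
Proof. by apply: (addrI (\pi_A 0)); rewrite -yb_piD !addr0. Qed.

Let one : A := \pi_A 1.
Let mul := lift_op2 A *%R.
Let scale (c : k) := lift_op1 A ( *:%R c).

Let repr_pi (f : freealg k X) : yb_ideal (repr (\pi_A f) - f).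
Proof. by apply/yb_eqP; rewrite reprK. Qed.

Let pi_mul (f g : freealg k X) : mul (\pi f) (\pi g) = \pi_A (f * g).
Proof.
rewrite /mul; unlock; apply/yb_eqP.
have [_ ID IM] := gen_ideal_ideal yb_relations.
set f' := repr _; set g' := repr _.
have -> : f' * g' - f * g = 1 * (f' - f) * g' + f * (g' - g) * 1.
  by rewrite mul1r mulr1 mulrBl mulrBr addrA subrK.
by apply: ID; apply: IM; apply: repr_pi.
Qed.

Let pi_scale c (f : freealg k X) : scale c (\pi f) = \pi_A (c *: f).
Proof.
rewrite /scale; unlock; apply/yb_eqP.
have [_ _ IM] := gen_ideal_ideal yb_relations.
set f' := repr _; have -> : c *: f' - c *: f = (c *: 1) * (f' - f) * 1.
  by rewrite mulr1 -scalerAl mul1r scalerBr.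
by apply: IM; apply: repr_pi.
Qed.

Let mulA : associative mul.
Proof.
elim/quotW=> f; elim/quotW=> g; elim/quotW=> h.
by rewrite (pi_mul g h) (pi_mul f g) !pi_mul mulrA.
Qed.
Let mul1x : left_id one mul.
Proof. by elim/quotW=> f; rewrite pi_mul mul1r. Qed.
Let mulx1 : right_id one mul.
Proof. by elim/quotW=> f; rewrite pi_mul mulr1. Qed.
Let mulDl : left_distributive mul +%R.
Proof.
elim/quotW=> f; elim/quotW=> g; elim/quotW=> h.
by rewrite (pi_mul f h) (pi_mul g h) -!yb_piD pi_mul mulrDl.
Qed.
Let mulDr : right_distributive mul +%R.
Proof.
elim/quotW=> f; elim/quotW=> g; elim/quotW=> h.
by rewrite (pi_mul f g) (pi_mul f h) -!yb_piD pi_mul mulrDr.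
Qed.
Let one_neq0 : one != 0.
Proof.
rewrite -yb_pi0; apply/eqP => /yb_eqP; rewrite subr0 => I1.
pose e : {fmonom X} := mone.
have eM (f g : freealg k X) : (f * g)@_e = f@_e * g@_e.
  exact: (rmorphM (mcoeff e : freealg k X -> k)).
have: (1 : freealg k X)@_e = 0.
  apply: (I1 [set f : freealg k X | f@_e = 0]); split; last first.
    have gen20 x y : (fgen x * fgen y)@_e = 0.
      by rewrite eM {1}/fgen mcoeffU1 -fdeg_eq0 fdegU mul0r.
    move=> _ [x [y ->]]; apply: etrans (mcoeffB _ _ _) _.
    exact: etrans (congr2 (fun a b => a - b) (gen20 _ _) (gen20 _ _)) (subrr 0).
  split=> [|f g /= f0 g0|a f b /= f0] /=.
  - by rewrite mcoeff0.
  - by rewrite mcoeffD f0 g0 addr0.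
  - by rewrite !eM f0 mulr0 mul0r.
by rewrite mcoeff1 eqxx; apply/eqP; rewrite oner_eq0.
Qed.

HB.instance Definition _ :=
  GRing.Zmodule_isNzRing.Build A mulA mul1x mulx1 mulDl mulDr one_neq0.

Let scaleA c d a : scale c (scale d a) = scale (c * d) a.
Proof. by elim/quotW: a => f; rewrite (pi_scale d) !pi_scale scalerA. Qed.
Let scale1 : left_id 1 scale.
Proof. by elim/quotW=> f; rewrite pi_scale scale1r. Qed.
Let scaleDr : right_distributive scale +%R.
Proof.
move=> c; elim/quotW=> f; elim/quotW=> g.
by rewrite (pi_scale c f) (pi_scale c g) -!yb_piD pi_scale scalerDr.
Qed.
Let scaleDl a : {morph scale^~ a : c d / c + d}.
Proof.
elim/quotW: a => f c d.
by rewrite /= (pi_scale c f) (pi_scale d f) pi_scale -yb_piD scalerDl.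
Qed.
HB.instance Definition _ :=
  GRing.Zmodule_isLmodule.Build k A scaleA scale1 scaleDr scaleDl.

Lemma yb_piM : {morph \pi_A : f g / f * g}.
Proof. by move=> f g; rewrite -pi_mul. Qed.
Lemma yb_piZ c : {morph \pi_A : f / c *: f}.
Proof. by move=> f; rewrite -pi_scale. Qed.

Let scaleAl (c : k) (a b : A) : c *: (a * b) = (c *: a) * b.
Proof.
elim/quotW: a => f; elim/quotW: b => g.
by rewrite -yb_piM -!yb_piZ -yb_piM scalerAl.
Qed.
HB.instance Definition _ :=
  GRing.LSemiModule_isLSemiAlgebra.Build k A scaleAl.
Let scaleAr (c : k) (a b : A) : c *: (a * b) = a * (c *: b).
Proof.
elim/quotW: a => f; elim/quotW: b => g.
by rewrite -yb_piM -!yb_piZ -yb_piM malg_scalerAr.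
Qed.
HB.instance Definition _ :=
  GRing.LSemiAlgebra_isSemiAlgebra.Build k A scaleAr.

Definition homogeneous (d : nat) : set (freealg k X) :=
  [set f | forall w, w \in msupp f -> fdeg w = d].

Definition yb_component (d : nat) : set A := \pi_A @` homogeneous d.

End YangBaxterAlgebra.

Arguments yb_relations {X} k r.
Arguments yb_ideal {X} k r.
Arguments homogeneous {X k} d.
Arguments yb_component {X} k r d.

Section YangBaxterEquation.
Context {X : Type} (r : X * X -> X * X).

Definition r12 (t : X * X * X) : X * X * X :=
  let: (x, y, z) := t in (r (x, y), z).

Definition r23 (t : X * X * X) : X * X * X :=
  let: (x, y, z) := t in (x, (r (y, z)).1, (r (y, z)).2).

Definition yang_baxter : Prop := r12 \o r23 \o r12 =1 r23 \o r12 \o r23.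

Definition left_nondegenerate : Prop :=
  forall x, bijective (fun y => (r (x, y)).1).

Definition lnd_idempotent_solution : Prop :=
  [/\ left_nondegenerate, idempotent_fun r & yang_baxter].

End YangBaxterEquation.

Section Groebner.
Context {k : fieldType} {X : choiceType} {n : nat}.
(* The enumeration x_1, ..., x_n of X which fixes the order x_1 < ... < x_n. *)
Variable x : n.-tuple X.
Local Notation F := (freealg k X).

Definition ranks (w : {fmonom X}) : seqlexi nat := [seq index a x | a <- w].

Definition deglex (u v : {fmonom X}) : bool :=
  (fdeg u < fdeg v)%N || (fdeg u == fdeg v) && (ranks u <= ranks v)%O.

Definition leading_monomial (f : F) (w : {fmonom X}) : Prop :=
  w \in msupp f /\ forall v, v \in msupp f -> deglex v w.

Definition leading_monomials (G : set F) : set {fmonom X} :=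
  [set w | exists2 g, G g & leading_monomial g w].

Definition groebner_basis (I G : set F) : Prop :=
  gen_ideal G = I /\
  forall f w, I f -> leading_monomial f w ->
    exists2 v : {fmonom X}, leading_monomials G v & infix v w.

Definition reduced_groebner_basis (I G : set F) : Prop :=
  [/\ groebner_basis I G,
      forall g w, G g -> leading_monomial g w -> g@_w = 1,
      ~ G 0 &
      forall g h w (v : {fmonom X}), G g -> G h -> h <> g ->
        w \in msupp g -> leading_monomial h v -> ~~ infix v w].

End Groebner.

Definition quadratic_binomial {k : fieldType} {X : choiceType}
    (f : freealg k X) : Prop :=
  exists a b c d : X, (a, b) <> (c, d) /\
    f = fgen k a * fgen k b - fgen k c * fgen k d.

(* X = {x_1, ..., x_n} is a set of PBW-generators of the Yang-Baxter algebra. *)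
Definition yb_pbw (k : fieldType) (X : choiceType) (r : X * X -> X * X)
    (n : nat) (x : n.-tuple X) : Prop :=
  exists2 G : set (freealg k X), groebner_basis x (yb_ideal k r) G &
    G `<=` homogeneous 2.

(* Main.v *)
From HB Require Import structures.
Require Import Defs.
From mathcomp Require Import all_boot all_order all_algebra.
From mathcomp Require Import finmap monalg.
From mathcomp Require Import mathcomp_extra boolp classical_sets functions.
From mathcomp Require Import cardinality zify.

Set Implicit Arguments.
Unset Strict Implicit.
Unset Printing Implicit Defensive.

Import Order.TTheory GRing.Theory.

Local Open Scope classical_set_scope.
Local Open Scope quotient_scope.
Local Open Scope ring_scope.

(** Write [lact a b] for the first component of [r (a, b)]. Idempotency says
    that [r (a, b)] is a fixed point, and by left nondegeneracy a fixed point
    is determined by its first component: [p] is fixed only if [lact p.1 p.2 =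
    p.1], which pins down [p.2]. Hence [r (a, b) = r (c, d)] as soon as [lact
    a b = lact c d] ([r_eq]), and since [lact a] is bijective there are
    exactly [n] classes of words of length 2: the dimension of the degree 2
    component is always [n].

    The same happens in every degree. Let [x1] be the first letter of the
    enumeration. In each class of two-letter words exactly one word starts
    with [x1], and it is the smallest. Rewriting [a b] with [a <> x1] into
    that word brings every word of length [m.+1] to the form [x1 ... x1 y]
    ([congr_nword]). No two of these are identified. Indeed let a word [a_1
    ... a_m y] act as [lact a_1 (... (lact a_m y))]; the first component of
    the Yang-Baxter equation is [lact p.1 (lact p.2 z) = lact a (lact b z)]
    for [p = r (a, b)], so that this value does not change along the relations
    ([act_r]), whereas it separates the words [x1 ... x1 y] because [lact x1]
    is injective. So the words [x1 ... x1 y] form a basis of each component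
    ([dim_yb_component]).

    Among the words with the same length and the same action, the normal one
    is the least in the degree-lexicographic order ([nword_lex_min]). An
    element of the ideal is killed by replacing each word with its normal form
    ([NF_ideal]), so its leading word cannot be normal and contains a factor
    [a b] with [a <> x1]. The binomials [a b - x1 y] with [a <> x1] therefore
    form a Groebner basis, whatever the enumeration, and it is reduced
    ([reduced_groebner_reductions]). It has [n * (n - 1)] elements, and since
    a reduced Groebner basis is unique ([reduced_groebner_basis_sub]), every
    count in the theorem is a count of these binomials.

    For the lower bound to be attained it then suffices to exhibit one
    solution of each order, and [r (a, b) = (b, b)] is one. *)

(** * Linear maps on the free algebra *)

(** Linearity in each factor, over an algebra whose elements are all reached
    from scalar multiples of the [m w] by addition. *)
Lemma linear_mul_eq0 (k : fieldType) (A : lalgType k) (V : lmodType k)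
    (L : {linear A -> V}) (T : Type) (m : T -> A) (b : A) :
  (forall c (f g : A), c *: (f * g) = f * (c *: g)) ->
  (forall P : A -> Prop, P 0 -> (forall f g, P f -> P g -> P (f + g)) ->
    (forall c w, P (c *: m w)) -> forall f, P f) ->
  (forall u v, L (m u * b * m v) = 0) -> forall a c, L (a * b * c) = 0.
Proof.
move=> scaleAr m_ind L0 a c.
elim/m_ind: a => [|a a' IHa IHa'|d u]; first by rewrite !mul0r linear0.
  by rewrite !mulrDl linearD IHa IHa' addr0.
elim/m_ind: c => [|c c' IHc IHc'|e v]; first by rewrite mulr0 linear0.
  by rewrite mulrDr linearD IHc IHc' addr0.
by rewrite -scaleAr -!scalerAl !linearZ /= L0 !scaler0.
Qed.

Section FreeAlgebra.
Context {k : fieldType} {X : choiceType}.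
Local Notation F := (freealg k X).

(** Words are kept as plain sequences, so that products of words are
    concatenations. *)
Definition mon (w : seq X) : F := << FMonom w >>.

Lemma monM u v : mon u * mon v = mon (u ++ v).
Proof.
rewrite /mon malgM_def fgmulUU mulr1; congr (<< _ *g _ >>).
by apply/eqP; rewrite fmP fmM.
Qed.

Lemma fgenE a : fgen k a = mon [:: a].
Proof. by rewrite /fgen /mon fmuE. Qed.

Lemma fgenM a b : fgen k a * fgen k b = mon [:: a; b].
Proof. by rewrite !fgenE monM. Qed.

Lemma mon_coef u (w : {fmonom X}) : (mon u)@_w = (u == w)%:R.
Proof. by rewrite mcoeffU1 fmP. Qed.

Lemma mon_sum (f : F) : f = \sum_(w <- msupp f) f@_w *: mon w.
Proof.
rewrite {1}[f]monalgE; apply: eq_bigr => w _.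
by rewrite malgZ_def /fgscale msuppU1 big_seq_fset1 mcoeffUU mulr1 fmK.
Qed.

Lemma mon_ind (P : F -> Prop) :
  P 0 -> (forall f g, P f -> P g -> P (f + g)) ->
  (forall c w, P (c *: mon w)) -> forall f, P f.
Proof. by move=> P0 PD PM f; rewrite (mon_sum f); apply: big_ind. Qed.

Section LinearExtension.
Context {V : lmodType k} (h : seq X -> V).

Definition linext (f : F) : V := \sum_(w <- msupp f) f@_w *: h w.

Lemma linextEw (d : {fset {fmonom X}}) f : (msupp f `<=` d)%fset ->
  linext f = \sum_(w <- d) f@_w *: h w.
Proof.
move=> le_fd; apply: big_fset_incl => // w _ /mcoeff_outdom ->.
by rewrite scale0r.
Qed.

Lemma linext_linear : linear linext.
Proof.
move=> c f g; pose d := (msupp f `|` msupp g)%fset.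
rewrite (@linextEw d) 1?(@linextEw d f) 1?(@linextEw d g);
  rewrite ?fsubsetUl ?fsubsetUr //.
  rewrite scaler_sumr -big_split; apply: eq_bigr => w _ /=.
  by rewrite mcoeffD mcoeffZ scalerDl scalerA.
by apply: fsubset_trans (msuppD_le _ _) _; apply: fsetSU; apply: msuppZ_le.
Qed.
HB.instance Definition _ := GRing.isLinear.Build k F V _ linext linext_linear.

Lemma linext_mon w : linext (mon w) = h w.
Proof. by rewrite /linext msuppU1 big_seq_fset1 mcoeffUU scale1r. Qed.

(** A linear map need not have an ideal as its kernel, but the elements [f]
    with all multiples [a f b] killed do form one. Words [u] and [v]
    suffice to test this on the generators. *)
Lemma linext_gen_ideal (S : set F) :
  (forall g u v, S g -> linext (mon u * g * mon v) = 0) ->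
  forall f, gen_ideal S f -> linext f = 0.
Proof.
move=> S0 f If.
have: [set f | forall a b, linext (a * f * b) = 0] f; last first.
  by move=> /(_ 1 1); rewrite mul1r mulr1.
apply: If; split=> [|g Sg]; last first.
  apply: (linear_mul_eq0 (L := linext) (@malg_scalerAr _ _) mon_ind) => u v.
  exact: S0.
split=> [a b|g1 g2 L1 L2 a b|c g d Lg a b] /=.
- by rewrite mulr0 mul0r linear0.
- rewrite (mulrDr a) (mulrDl (a * g1)) linearD.
  by rewrite [LHS](congr2 +%R (L1 a b) (L2 a b)) addr0.
have mA (R : nzRingType) (x y z s t : R) :
  x * (y * z * s) * t = x * y * z * (s * t) by rewrite !mulrA.
by rewrite (mA F) Lg.
Qed.

End LinearExtension.

End FreeAlgebra.

(** * Leading words and uniqueness of the reduced Groebner basis *)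

Section Groebner.
Context {k : fieldType} {X : choiceType} {n : nat} (x : n.-tuple X).
Hypothesis memx : forall a, a \in x.
Local Notation F := (freealg k X).
Local Notation deglex := (deglex x).
Local Notation leading_monomial := (leading_monomial x).
Implicit Types (u v w : {fmonom X}) (f g : F) (G : set F).

Lemma deglex_refl : reflexive deglex.
Proof. by move=> w; rewrite /Defs.deglex eqxx lexx orbT. Qed.

Lemma deglex_trans : transitive deglex.
Proof.
move=> v u w /orP[uv|/andP[/eqP uv Ruv]] /orP[vw|/andP[/eqP vw Rvw]].
- by rewrite /Defs.deglex (ltn_trans uv vw).
- by rewrite /Defs.deglex -vw uv.
- by rewrite /Defs.deglex uv vw.
- by rewrite /Defs.deglex uv vw eqxx (le_trans Ruv Rvw) orbT.
Qed.

Lemma deglex_total : total deglex.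
Proof.
move=> u v; rewrite /Defs.deglex (eq_sym (fdeg v)).
by case: ltngtP => //= _; apply: le_total.
Qed.

Lemma deglex_anti u v : deglex u v -> deglex v u -> u = v.
Proof.
have idx_inj : injective (index^~ x : X -> nat).
  by move=> a b ab; rewrite -(nth_index a (memx a)) ab nth_index.
move=> /orP[uv|/andP[/eqP uv Ruv]] /orP[vu|/andP[/eqP vu Rvu]].
- by have := ltn_trans uv vu; rewrite ltnn.
- by move: uv; rewrite vu ltnn.
- by move: vu; rewrite uv ltnn.
- apply/eqP; rewrite fmP; apply/eqP/(inj_map idx_inj).
  by have /le_anti : (ranks x u <= ranks x v <= ranks x u)%O by rewrite Ruv.
Qed.

Lemma deglex_size u v : deglex u v -> (size u <= size v)%N.
Proof. by rewrite -!fdegE => /orP[/ltnW|/andP[/eqP ->]]. Qed.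

Lemma leading_monomial_exists f : f != 0 -> exists w, leading_monomial f w.
Proof.
move=> f0; have : msupp f != fset0 by rewrite msupp_eq0.
case/fset0Pn => w0 w0f.
suff: forall s : seq {fmonom X}, w0 \in s ->
    exists2 w, w \in s & forall v, v \in s -> deglex v w.
  by move=> /(_ _ w0f)[w wf maxw]; exists w; split.
move=> s; have := sort_sorted deglex_total s.
move=> + w0s; have : w0 \in sort deglex s by rewrite mem_sort.
case/lastP E: (sort deglex s) => [|t w] // _.
have memE v : (v \in s) = (v \in rcons t w) by rewrite -E mem_sort.
rewrite (sorted_pairwise deglex_trans) pairwise_rcons => /andP[/allP tw _].
exists w; first by rewrite memE mem_rcons mem_head.
move=> v; rewrite memE mem_rcons inE => /orP[/eqP ->|/tw] //.
exact: deglex_refl.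
Qed.

Lemma leading_monomial_uniq f u v :
  leading_monomial f u -> leading_monomial f v -> u = v.
Proof.
move=> [uf maxu] [vf maxv].
by apply: deglex_anti; [exact: maxv | exact: maxu].
Qed.

Lemma infix_size_eq u v : infix u v -> (size v <= size u)%N -> u = v.
Proof.
move=> /infixP[s [t vE]]; rewrite vE !size_cat addnCA -leq_subRL // subnn.
rewrite leqn0 addn_eq0 => /andP[/nilP s0 /nilP t0].
by apply/eqP; rewrite fmP vE s0 t0 cats0.
Qed.

(** A leading word of [G] is also one of [H]: it contains a leading word of
    [H], which contains one of [G], and interreduction makes the three equal.
    If [g] and [h] share their leading word [w], that word cancels in [g - h].
    The leading word of [g - h] would be a word of [g] or of [h] other than
    [w], and interreduction again forbids it to contain a leading word of that
    basis other than [w]; being at most [w], it cannot contain [w] either. *)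
Lemma reduced_groebner_basis_sub (I G H : set F) :
  (forall f g, I f -> I g -> I (f - g)) ->
  reduced_groebner_basis x I G -> reduced_groebner_basis x I H -> G `<=` H.
Proof.
move=> subI [[genG leadG] monG nG0 redG] [[genH leadH] monH nH0 redH] g Gg.
have GI f : G f -> I f by move=> Gf; rewrite -genG => J [_]; apply.
have HI f : H f -> I f by move=> Hf; rewrite -genH => J [_]; apply.
have lead_unique (Q : set F) f h u v w :
    (forall g h w v, Q g -> Q h -> h <> g -> w \in msupp g ->
      leading_monomial h v -> ~~ infix v w) ->
    Q f -> Q h -> u \in msupp f -> leading_monomial h v -> infix v u -> h = f.
  move=> redQ Qf Qh uf hv vu; apply: contrapT => hf.
  by move: (redQ _ _ _ _ Qf Qh hf uf hv); rewrite vu.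
have [|w gw] := @leading_monomial_exists g.
  by apply/eqP => g0; apply: nG0; rewrite -g0.
have [v [h Hh hv] vw] := leadH _ _ (GI _ Gg) gw.
have hw : leading_monomial h w.
  have [v' [g' Gg' gv'] v'v] := leadG _ _ (HI _ Hh) hv.
  have v'w := infix_trans v'v vw.
  have gg' : g' = g := lead_unique _ _ _ _ _ w redG Gg Gg' gw.1 gv' v'w.
  rewrite gg' in gv'; have v'E := leading_monomial_uniq gv' gw.
  by rewrite -(infix_size_eq vw) // -v'E; apply: size_infix.
suff gh : g = h by rewrite gh.
have [/eqP|gh0] := eqVneq (g - h) 0; first by rewrite subr_eq0 => /eqP.
have [u ghu] := leading_monomial_exists gh0.
have nuw : u != w.
  apply/eqP => uw; have := ghu.1; rewrite uw -mcoeff_neq0 mcoeffB.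
  by rewrite (monG _ _ Gg gw) (monH _ _ Hh hw) subrr eqxx.
have Igh := subI _ _ (GI _ Gg) (HI _ Hh).
have /fsubsetP/(_ _ ghu.1) := msuppB_le g h; rewrite in_fsetU => /orP[ug|uh].
  have [v' [g' Gg' gv'] v'u] := leadG _ _ Igh ghu.
  have gg' : g' = g := lead_unique _ _ _ _ _ w redG Gg Gg' ug gv' v'u.
  rewrite gg' in gv'; rewrite (leading_monomial_uniq gv' gw) in v'u.
  case/eqP: nuw; rewrite (infix_size_eq v'u) //.
  by apply: deglex_size; apply: gw.2.
have [v' [h' Hh' hv'] v'u] := leadH _ _ Igh ghu.
have hh' : h' = h := lead_unique _ _ _ _ _ w redH Hh Hh' uh hv' v'u.
rewrite hh' in hv'; rewrite (leading_monomial_uniq hv' hw) in v'u.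
case/eqP: nuw; rewrite (infix_size_eq v'u) //.
by apply: deglex_size; apply: hw.2.
Qed.

End Groebner.

(** * Classes of words modulo the Yang-Baxter relations *)

Section Solution.
Context {k : fieldType} {X : choiceType} (r : X * X -> X * X).
Hypothesis solr : lnd_idempotent_solution r.
Local Notation F := (freealg k X).
Local Notation I := (yb_ideal k r).
Implicit Types (a b c d y z : X) (u v w s t : seq X) (f g : F).

Definition lact a b := (r (a, b)).1.

Lemma lact_inj a : injective (lact a).
Proof. by case: solr => lnd _ _; apply: bij_inj (lnd a). Qed.

Lemma lact_r a b : lact (r (a, b)).1 (r (a, b)).2 = lact a b.
Proof.
case: solr => _ idr _; rewrite /lact -surjective_pairing.
by have := congr1 fst (idr (a, b)).
Qed.

(** Both pairs are fixed points of [r] with the same first component [p'],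
    hence with the same second component, by injectivity of [lact p']. *)
Lemma r_eq a b c d : lact a b = lact c d -> r (a, b) = r (c, d).
Proof.
have := lact_r a b; have := lact_r c d; rewrite /lact.
case: (r (a, b)) (r (c, d)) => [p q] [p' q'] /= rp' + pE; rewrite {}pE => rp.
by congr (_, _); apply: (@lact_inj p'); rewrite /lact rp rp'.
Qed.

(** This is the first component of the Yang-Baxter equation at
    [(a, b, z)]. *)
Lemma lact_braid a b z :
  lact (r (a, b)).1 (lact (r (a, b)).2 z) = lact a (lact b z).
Proof.
case: solr => _ _ /(_ (a, b, z)) /=.
rewrite /r12 /r23 /lact /=; case: (r (a, b)) => p q /=.
by case: (r (p, _)) => ? ?; case: (r (a, _)) => ? ? [].
Qed.

(** The last letter of a word is acted upon by the letters before it; the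
    empty word has no last letter, whence the option. *)
Definition act w : option X :=
  foldr (fun a o => Some (oapp (lact a) a o)) None w.

(** For [v] empty this is the equality of first components; for [v]
    nonempty it is the braid identity for [lact]. *)
Lemma act_r a b c d v :
  r (a, b) = r (c, d) -> act [:: a, b & v] = act [:: c, d & v].
Proof.
move=> rE; rewrite /=; case: (act v) => [z|] /=; last by rewrite /lact rE.
by rewrite -(lact_braid a) -(lact_braid c) rE.
Qed.

Lemma act_cat w v v' : act v = act v' -> act (w ++ v) = act (w ++ v').
Proof. by move=> vE; elim: w => //= a w ->. Qed.

Lemma act_None w : act w = None -> w = [::].
Proof. by case: w. Qed.

Let idealI : two_sided_ideal I := gen_ideal_ideal _.

Lemma ideal0 : I 0. Proof. by case: idealI. Qed.

Lemma idealD f g : I f -> I g -> I (f + g).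
Proof. by case: idealI => _ + _; apply. Qed.

Lemma idealZ e f : I f -> I (e *: f).
Proof.
case: idealI => _ _ IM If; rewrite -[f]mul1r scalerAl -[X in I X]mulr1.
exact: IM.
Qed.

Lemma idealB f g : I f -> I g -> I (f - g).
Proof.
by move=> If Ig; apply: idealD => //; rewrite -scaleN1r; apply: idealZ.
Qed.

Definition congr_words u v := I (mon u - mon v).

Lemma congr_refl u : congr_words u u.
Proof. by rewrite /congr_words subrr; apply: ideal0. Qed.

Lemma congr_trans v u w : congr_words u v -> congr_words v w -> congr_words u w.
Proof.
move=> uv vw; rewrite /congr_words; have -> : mon u - mon w
  = (mon u - mon v) + (mon v - mon w) :> F by rewrite addrA subrK.
exact: (idealD uv vw).
Qed.

Lemma congr_sym u v : congr_words u v -> congr_words v u.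
Proof.
by move=> uv; rewrite /congr_words -opprB -sub0r; apply: idealB ideal0 _.
Qed.

Lemma congr_cat s t u v :
  congr_words u v -> congr_words (s ++ u ++ t) (s ++ v ++ t).
Proof.
case: idealI => _ _ IM uv; rewrite /congr_words -!monM.
rewrite -mulrBr -mulrBl mulrA; exact: IM.
Qed.

(** [a b] and [c d] are both congruent to [r (a, b) = r (c, d)]. *)
Lemma congr_lact a b c d :
  lact a b = lact c d -> congr_words [:: a; b] [:: c; d].
Proof.
have congr_r y z : congr_words [:: y; z] [:: (r (y, z)).1; (r (y, z)).2].
  by move=> J [_]; apply; exists y, z; rewrite !fgenM.
move=> /r_eq rE; apply: congr_trans (congr_r a b) _.
by rewrite rE; apply: congr_sym.
Qed.

(** * Normal forms *)

Section NormalForm.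
Context (x1 : X) (h : X -> X).
Hypotheses (lactK : cancel (lact x1) h) (lactKV : cancel h (lact x1)).

Definition nword m y := rcons (nseq m x1) y.

(** The exponent [(size w).-1] is the number of letters [x1] whose action has
    to be undone, so that [nf w] acts as [w] does. *)
Definition nf w :=
  if act w is Some y then nword (size w).-1 (iter (size w).-1 h y) else [::].

Lemma act_nword m y : act (nword m y) = Some (iter m (lact x1) y).
Proof. by elim: m => //= m ->. Qed.

Lemma size_nword m y : size (nword m y) = m.+1.
Proof. by rewrite size_rcons size_nseq. Qed.

Lemma iter_lactKV m : cancel (iter m h) (iter m (lact x1)).
Proof. by elim: m => // m IHm y; rewrite iterSr /= lactKV. Qed.

Lemma iter_lactK m : cancel (iter m (lact x1)) (iter m h).
Proof. by elim: m => // m IHm y; rewrite iterSr /= lactK. Qed.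

Lemma nf_nword m y : nf (nword m y) = nword m y.
Proof. by rewrite /nf act_nword size_nword iter_lactK. Qed.

Lemma act_nf w : act (nf w) = act w.
Proof.
by rewrite /nf; case actw: (act w) => [y|//]; rewrite act_nword iter_lactKV.
Qed.

Lemma nf_nwordE m w : size w = m.+1 -> exists y, nf w = nword m y.
Proof. by case: w => // a w [<-]; rewrite /nf /=; eexists. Qed.

Lemma size_nf w : size (nf w) = size w.
Proof.
by case: w => // a w; rewrite /nf /= size_nword.
Qed.

(** The head [a] of a word [a b ...] can be traded for [x1], changing only
    [b], and one goes on with the tail. *)
Lemma congr_nword a v : exists y, congr_words (a :: v) (nword (size v) y).
Proof.
elim: v a => [|b v IHv] a; first by exists a; apply: congr_refl.
have [y vy] := IHv (h (lact a b)); exists y.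
apply: (@congr_trans [:: x1, h (lact a b) & v]).
  by have /= := congr_cat [::] v (congr_lact (esym (lactKV (lact a b)))).
by have /= := congr_cat [:: x1] [::] vy; rewrite !cats0.
Qed.

Definition NF : F -> F := linext (fun w => mon (nf w)).

(** [nf w] depends only on the length and the action of [w], which the two
    words of a relation share in every context. *)
Lemma NF_ideal f : I f -> NF f = 0.
Proof.
apply: linext_gen_ideal => _ u v [a [b ->]].
rewrite !fgenM mulrBr mulrBl !monM linearB /= !linext_mon.
set p := r (a, b).
have nfE : nf ((u ++ [:: a; b]) ++ v) = nf ((u ++ [:: p.1; p.2]) ++ v).
  rewrite /nf -!catA (@act_cat u _ ([:: p.1; p.2] ++ v)) ?size_cat //.
  by apply: act_r; apply: r_eq; rewrite lact_r.
by rewrite nfE subrr.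
Qed.

Lemma nf_congr u v : congr_words u v -> nf u = nf v.
Proof.
move=> /NF_ideal; rewrite /NF linearB /= !linext_mon.
move=> /malgP/(_ (FMonom (nf u))); rewrite mcoeff0 mcoeffB !mon_coef eqxx.
by case: eqP => [->|_] //; rewrite subr0 => /eqP; rewrite oner_eq0.
Qed.

(** Some word [x1 ... x1 y] is congruent to [w]; congruent words have the
    same normal form, so that word is [nf w]. *)
Lemma congr_nf w : congr_words w (nf w).
Proof.
case: w => [|a w]; first exact: congr_refl.
have [y wy] := congr_nword a w.
by rewrite (nf_congr wy) nf_nword.
Qed.

(** * Dimension of the graded components *)

Section Enumeration.
Context {n : nat} (x : n.-tuple X).
Hypotheses (uniqx : uniq x) (memx : forall a, a \in x).

Lemma tnth_nword_inj m : injective (fun i : 'I_n => nword m (tnth x i)).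
Proof. by move=> i j /rcons_inj[/(tuple_uniqP _ uniqx)]. Qed.

Local Notation A := (yb_algebra k r).
Local Notation pi := (\pi_A : F -> A).

Lemma pi_sum (T : Type) (l : seq T) (c : T -> k) (f : T -> F) :
  pi (\sum_(t <- l) c t *: f t) = \sum_(t <- l) c t *: pi (f t).
Proof.
rewrite (big_morph pi (@yb_piD _ _ _) (@yb_pi0 _ _ _)).
by apply: eq_bigr => t _; rewrite yb_piZ.
Qed.

Lemma dim_yb_component (d : nat) : has_dim (yb_component k r d.+1) n.
Proof.
exists (fun i => pi (mon (nword d (tnth x i)))); split.
- move=> i; exists (mon (nword d (tnth x i))) => // w.
  by rewrite msuppU1 in_fset1 => /eqP ->; rewrite fdegE size_nword.
- move=> c; rewrite -pi_sum -yb_pi0 => /yb_eqP; rewrite subr0.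
  move=> /NF_ideal; rewrite /NF linear_sum /= => NF0 j.
  have := congr1 (mcoeff (FMonom (nword d (tnth x j)))) NF0.
  rewrite mcoeff0 raddf_sum /= (bigD1 j) //= big1 ?addr0 => [|i /negPf ij].
    by rewrite linearZ /= linext_mon nf_nword mcoeffZ mon_coef eqxx mulr1.
  rewrite linearZ /= linext_mon nf_nword mcoeffZ mon_coef.
  by rewrite (inj_eq (@tnth_nword_inj d)) ij mulr0.
move=> _ [f fd <-].
(* [f] has no word of another degree; such a word gets an arbitrary index. *)
have /choice[ix ixP] : forall w : {fmonom X}, exists i, fdeg w = d.+1 ->
    pi (mon w) = pi (mon (nword d (tnth x i))).
  move=> w; have [wd|nwd] := eqVneq (fdeg w) d.+1.
    have [y nfw] := nf_nwordE wd; have /tnthP[i yi] := memx y.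
    by exists i => _; apply/yb_eqP; rewrite -yi -nfw; apply: congr_nf.
  by have /tnthP[i _] := memx x1; exists i => /eqP; rewrite (negPf nwd).
exists (fun i => \sum_(w <- msupp f | ix w == i) f@_w).
rewrite {1}(mon_sum f) pi_sum (partition_big ix xpredT) //=.
apply: eq_bigr => i _; rewrite scaler_suml.
rewrite big_seq_cond [RHS]big_seq_cond.
by apply: eq_bigr => w /andP[/fd/ixP -> /eqP ->].
Qed.

(** * The reduced Groebner basis *)

Hypothesis index_x1 : index x1 x = 0%N.
Local Notation deglex := (deglex x).
Local Notation leading_monomial := (leading_monomial x).

Lemma index_gt0 a : a != x1 -> (0 < index a x)%N.
Proof.
rewrite lt0n; apply: contraNneq => a0.
by rewrite -(nth_index x1 (memx a)) a0 -index_x1 nth_index.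
Qed.

(** A word starting with another letter than [x1] is larger at once. If it
    starts with [x1], injectivity of [lact x1] gives its tail the same action
    as the tail of the normal word. *)
Lemma nword_lex_min m y v :
  size v = m.+1 -> act v = act (nword m y) ->
  ((map (index^~ x) (nword m y) : seqlexi nat) <= map (index^~ x) v)%O.
Proof.
elim: m v => [|m IHm] [|a v] //= [sz_v].
  by rewrite (size0nil sz_v) => -[->].
rewrite act_nword /= lexi_cons leEnat; case: (eqVneq a x1) => [->|ax1] actE.
  rewrite leqnn /=; apply: IHm => //; rewrite act_nword.
  case: (act v) (@act_None v) actE => [z _ [/lact_inj ->] //|/(_ erefl) v0].
  by rewrite v0 in sz_v.
by rewrite index_x1 leq0n (leqNgt (index a x)) index_gt0.
Qed.

Lemma nf_deglex w : deglex (FMonom (nf w)) (FMonom w).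
Proof.
rewrite /Defs.deglex !fdegE /= size_nf eqxx ltnn /=.
case: w => [|a v]; first exact: lexx.
have [y nfw] := @nf_nwordE (size v) (a :: v) erefl.
by rewrite /ranks nfw; apply: nword_lex_min => //; rewrite -nfw act_nf.
Qed.

(** If [w] were normal, the words of [f] with normal form [w] would be at
    least [w], and at most [w] as [w] leads: [w] alone would contribute to its
    coefficient in [NF f = 0]. *)
Lemma leading_monomial_nf f (w : {fmonom X}) :
  I f -> leading_monomial f w -> nf w <> w.
Proof.
move=> If [wf maxw] nfw; move: (wf); rewrite -mcoeff_neq0.
have := congr1 (mcoeff w) (NF_ideal If); rewrite mcoeff0 raddf_sum /=.
rewrite (big_fsetD1 w wf) /= [X in X + _]mcoeffZ mon_coef nfw eqxx mulr1.
rewrite big_seq big1 ?addr0 => [-> /eqP //|v].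
rewrite in_fsetD1 => /andP[vw vf]; rewrite mcoeffZ mon_coef.
case: eqP => [nfv|_]; last by rewrite mulr0.
case/eqP: vw; apply: (deglex_anti memx (maxw _ vf)).
by rewrite -[w]fmK -[v]fmK -nfv nf_deglex.
Qed.

Lemma nf_reducible w :
  nf w <> w -> exists a b, a != x1 /\ infix [:: a; b] w.
Proof.
case/lastP: w => [|s b] // nfw.
have [/all_pred1P sE|] := boolP (all (pred1 x1) s).
  by case: nfw; rewrite sE; apply: nf_nword.
case/allPn => a /splitPr[s1 s2] ax1; exists a, (head b s2); split=> //.
rewrite rcons_cat /=; apply/infixP; exists s1, (behead (rcons s2 b)).
by case: s2.
Qed.

Definition reduction a b : F := mon [:: a; b] - mon (nf [:: a; b]).

Definition reductions : set F :=
  [set f | exists a b, a != x1 /\ f = reduction a b].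

Lemma nf_word2 a b : nf [:: a; b] = [:: x1; h (lact a b)].
Proof. by []. Qed.

Lemma reduction_coef a b : a != x1 -> (reduction a b)@_(FMonom [:: a; b]) = 1.
Proof.
move=> ax1; rewrite mcoeffB !mon_coef eqxx nf_word2 eqseq_cons.
by rewrite eq_sym (negPf ax1) subr0.
Qed.

Lemma msupp_reduction a b (w : {fmonom X}) :
  w \in msupp (reduction a b) ->
  w = [:: a; b] :> seq X \/ w = nf [:: a; b] :> seq X.
Proof.
rewrite -mcoeff_neq0 mcoeffB !mon_coef.
case: ([:: a; b] =P w :> seq X) => [->|_]; first by left.
by case: (nf [:: a; b] =P w :> seq X) => [->|_]; [right | rewrite subrr eqxx].
Qed.

Lemma leading_reduction a b : a != x1 ->
  leading_monomial (reduction a b) (FMonom [:: a; b]).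
Proof.
move=> ax1; split; first by rewrite -mcoeff_neq0 reduction_coef ?oner_eq0.
move=> v /msupp_reduction[] vE; rewrite -(fmK v) vE; first exact: deglex_refl.
exact: nf_deglex.
Qed.

Lemma leading_reductionE a b (w : {fmonom X}) : a != x1 ->
  leading_monomial (reduction a b) w -> w = [:: a; b] :> seq X.
Proof.
move=> ax1 lw.
by rewrite (leading_monomial_uniq memx lw (leading_reduction b ax1)).
Qed.

Lemma reduction_ideal a b : I (reduction a b).
Proof. exact: congr_nf. Qed.

(** A relation [a b - r (a, b)] is the difference of two reductions, since both
    words have the same normal form; a reduction with [a = x1] vanishes. *)
Lemma gen_reductions : gen_ideal reductions = I.
Proof.
apply/seteqP; split=> f If.
  apply: If; split; first exact: gen_ideal_ideal.
  by move=> _ [a [b [_ ->]]]; apply: reduction_ideal.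
have [J0 JD JM] := gen_ideal_ideal reductions.
have Jred a b : gen_ideal reductions (reduction a b).
  have [->|ax1] := eqVneq a x1; last by move=> J [_]; apply; exists a, b.
  by rewrite /reduction nf_word2 lactK subrr.
apply: If; split; first exact: gen_ideal_ideal.
move=> _ [a [b ->]]; rewrite !fgenM.
set p := r (a, b); have nfE : nf [:: p.1; p.2] = nf [:: a; b].
  by rewrite !nf_word2 lact_r.
have -> : mon [:: a; b] - mon [:: p.1; p.2]
    = reduction a b + (- 1) * reduction p.1 p.2 * 1.
  by rewrite mulN1r mulr1 /reduction nfE opprB addrA subrK.
by apply: JD => //; apply: JM.
Qed.

Lemma groebner_reductions : groebner_basis x I reductions.
Proof.
split=> [|f w If lw]; first exact: gen_reductions.
have [a [b [ax1 abw]]] := nf_reducible (leading_monomial_nf If lw).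
exists (FMonom [:: a; b]) => //; exists (reduction a b); first by exists a, b.
exact: leading_reduction.
Qed.

Lemma reduced_groebner_reductions : reduced_groebner_basis x I reductions.
Proof.
split.
- exact: groebner_reductions.
- move=> _ w [a [b [ax1 ->]]] lw.
  by rewrite -[w]fmK (leading_reductionE ax1 lw) reduction_coef.
- move=> [a [b [ax1 /esym red0]]]; have := reduction_coef b ax1.
  by rewrite red0 mcoeff0 => /esym/eqP; rewrite oner_eq0.
move=> _ _ w v [a [b [ax1 ->]]] [c [d [cx1 ->]]] neq wab lv.
apply/negP; rewrite (leading_reductionE cx1 lv) => cdw.
have wE : FMonom [:: c; d] = w.
  apply: infix_size_eq; first exact: cdw.
  by case: (msupp_reduction wab) => ->; rewrite ?size_nf.
case: (msupp_reduction wab); rewrite -wE /=.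
  by case=> ca db; case: neq; rewrite ca db.
by case=> cx; rewrite cx eqxx in cx1.
Qed.

Lemma reduction_binomial a b : a != x1 -> quadratic_binomial (reduction a b).
Proof.
move=> ax1; exists a, b, x1, (h (lact a b)); rewrite !fgenM; split=> //.
by case=> ax; rewrite ax eqxx in ax1.
Qed.

Lemma reduction_homogeneous : reductions `<=` homogeneous 2.
Proof.
by move=> _ [a [b [_ ->]]] w /msupp_reduction[]; rewrite fdegE => ->.
Qed.

(** * Size of the reduced basis and the theorem *)

Section FiniteBasis.
Context {N : nat} (p : 'I_N -> X * X).
Hypotheses (p_inj : injective p) (p_fst : forall i, (p i).1 != x1).
Hypothesis p_surj : forall a b, a != x1 -> exists i, p i = (a, b).
Local Notation red i := (reduction (p i).1 (p i).2).

Lemma reduction_lin_indep : lin_indep (fun i => red i).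
Proof.
move=> c c0 j; pose wj := FMonom [:: (p j).1; (p j).2].
have := congr1 (mcoeff wj) c0; rewrite mcoeff0 raddf_sum /= (bigD1 j) //=.
rewrite [X in X + _]mcoeffZ (reduction_coef _ (p_fst j)) mulr1.
rewrite big1 ?addr0 // => i ij; rewrite mcoeffZ.
have [-> | /eqP/eqP] := eqVneq (red i)@_wj 0; first by rewrite mulr0.
rewrite mcoeff_neq0 => /msupp_reduction[[e1 e2]|].
  case/eqP: ij; apply: p_inj.
  by rewrite (surjective_pairing (p i)) -e1 -e2 -surjective_pairing.
by rewrite nf_word2 => -[e1]; have := p_fst j; rewrite e1 eqxx.
Qed.

Lemma range_reduction : range (fun i => red i) = reductions.
Proof.
apply/seteqP; split=> [_ [i _ <-]|_ [a [b [ax1 ->]]]].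
  by exists (p i).1, (p i).2.
by have [i pi] := p_surj b ax1; exists i; [by [] | rewrite pi].
Qed.

Lemma card_leading_reductions :
  (leading_monomials x reductions #= `I_N)%card.
Proof.
pose w_ i : {fmonom X} := FMonom [:: (p i).1; (p i).2].
have -> : leading_monomials x reductions = range w_.
  apply/seteqP; split=> [w [_ [a [b [ax1 ->]]] lw]|_ [i _ <-]].
    have [i pi] := p_surj b ax1; exists i; first by [].
    by rewrite -[w]fmK (leading_reductionE ax1 lw) /w_ pi.
  exists (red i); first by exists (p i).1, (p i).2.
  exact: leading_reduction.
have w_inj : {in [set: 'I_N] &, injective w_}.
  move=> i j _ _ [e1 e2]; apply: p_inj.
  by rewrite (surjective_pairing (p i)) e1 e2 -surjective_pairing.
apply: card_eq_trans (inj_card_eq w_inj) _.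
by rewrite card_eq_sym; apply: card_II.
Qed.

End FiniteBasis.

End Enumeration.

End NormalForm.
End Solution.

Lemma mem_full_tuple (X : finType) n (x : n.-tuple X) :
  #|X| = n -> uniq x -> forall a, a \in x.
Proof.
move=> cardX /card_uniqP; rewrite size_tuple => cardx a.
have /subset_cardP xX : #|x| = #|X| by rewrite cardX.
by rewrite (xX (subset_predT _)).
Qed.

Lemma first_letter (X : choiceType) (r : X * X -> X * X) n (x : n.-tuple X) :
  (0 < n)%N -> uniq x -> left_nondegenerate r ->
  exists x1 h,
    [/\ cancel (lact r x1) h, cancel h (lact r x1) & index x1 x = 0%N].
Proof.
move=> n_gt0 uniqx lnd; pose x1 := tnth x (Ordinal n_gt0).
have [h hK hKV] := lnd x1; exists x1, h; split=> //.
by rewrite /x1 (tnth_nth x1) index_uniq ?size_tuple.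
Qed.

Definition obstructions (X : finType) (x1 : X) : {set X * X} :=
  [set p | p.1 != x1]%SET.

Lemma card_obstructions (X : finType) (x1 : X) :
  #|obstructions x1| = (#|X| * (#|X| - 1))%N.
Proof.
have -> : obstructions x1 = finset.setX [set~ x1]%SET [set: X]%SET.
  by apply/setP => p; rewrite !inE andbT.
by rewrite cardsX cardsC1 cardsT mulnC subn1.
Qed.

Lemma projection_solution (X : Type) :
  lnd_idempotent_solution (fun p : X * X => (p.2, p.2)).
Proof. by split=> [a|p|[[a b] c]] //; exists id. Qed.

Local Open Scope classical_set_scope.
Local Open Scope nat_scope.

Theorem theorem4p11 (k : fieldType) (n : nat) (n_ge2 : 2 <= n) :
  (forall (X : finType) (r : X * X -> X * X) (x : n.-tuple X),
    #|X| = n -> uniq x -> lnd_idempotent_solution r -> yb_pbw k r x ->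
    [/\ exists2 m, has_dim (yb_component k r 2) m & n <= m <= 'C(n, 2) + 1,
        (exists G, reduced_groebner_basis x (yb_ideal k r) G) /\
        (forall G, reduced_groebner_basis x (yb_ideal k r) G ->
          exists N : nat,
            [/\ exists2 b : 'I_N -> freealg k X, lin_indep b & range b = G,
                forall g, G g -> quadratic_binomial g,
                (leading_monomials x G #= `I_N)%card &
                'C(n.+1, 2) - 1 <= N <= n * (n - 1)]) &
        has_dim (yb_component k r 2) n ->
        forall d, 1 <= d -> has_dim (yb_component k r d) n]) /\
  (exists (X : finType) (r : X * X -> X * X) (x : n.-tuple X),
    [/\ #|X| = n /\ uniq x, lnd_idempotent_solution r, yb_pbw k r x &
        has_dim (yb_component k r 2) n]).
Proof.
have n_gt0 : 0 < n by apply: ltnW.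
(* Both bounds say that n - 1 <= n * (n - 1) / 2. *)
have bounds : n <= 'C(n, 2) + 1 /\ 'C(n.+1, 2) - 1 <= n * (n - 1).
  have nn : 'C(n, 2) * 2 = n * (n - 1).
    by rewrite -[2]/(2`!) bin_ffact ffactnS ffactn1 subn1.
  by rewrite binS bin1; nia.
split=> [X r x cardX uniqx solr _|].
  have memx := mem_full_tuple cardX uniqx.
  have [lnd _ _] := solr.
  have [x1 [h [lactK lactKV index_x1]]] := first_letter n_gt0 uniqx lnd.
  have dimA d : has_dim (yb_component k r d.+1) n.
    exact: (dim_yb_component solr lactK lactKV uniqx memx).
  have redR := reduced_groebner_reductions solr lactK lactKV memx index_x1.
  split; first by exists n; [exact: dimA | rewrite leqnn bounds.1].
    split=> [|G redG]; first by eexists; apply: redR.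
    have -> : G = reductions r x1 h.
      have subI := @idealB k X r.
      by apply/seteqP; split; apply: (reduced_groebner_basis_sub memx subI).
    exists #|obstructions x1|; pose p (i : 'I_#|obstructions x1|) := enum_val i.
    have p_inj : injective p by apply: enum_val_inj.
    have p_fst i : (p i).1 != x1 by have := enum_valP i; rewrite inE.
    have p_surj a b : a != x1 -> exists i, p i = (a, b).
      move=> ax1; have abP : (a, b) \in obstructions x1 by rewrite inE.
      by exists (enum_rank_in abP (a, b)); apply: enum_rankK_in.
    split.
    - exists (fun i => reduction r x1 h (p i).1 (p i).2).
        exact: reduction_lin_indep.
      exact: range_reduction.
    - by move=> _ [a [b [ax1 ->]]]; apply: reduction_binomial.
    - exact: (card_leading_reductions solr lactKV memx index_x1
                p_inj p_fst p_surj).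
    - by rewrite card_obstructions cardX leqnn bounds.2.
  by move=> _ [|d].
pose r (p : 'I_n * 'I_n) := (p.2, p.2).
have solr : lnd_idempotent_solution r := projection_solution _.
have cardX : #|'I_n| = n by rewrite card_ord.
have uniqx : uniq (ord_tuple n) by rewrite val_ord_tuple enum_uniq.
have memx := mem_full_tuple cardX uniqx.
have [lnd _ _] := solr.
have [x1 [h [lactK lactKV index_x1]]] := first_letter n_gt0 uniqx lnd.
exists 'I_n, r, (ord_tuple n); split=> //.
  exists (reductions r x1 h); last exact: reduction_homogeneous.
  exact: groebner_reductions.
exact: (dim_yb_component solr lactK lactKV uniqx memx).
Qed.
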